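(* Let $S$ be a positive integer and fix a non-uniform probability distribution $(p_1,\dots,p_S)$ on $\{1,\dots,S\}$. For $i\ge 2$, let $X_i$ be the number of active nodes at level $i$ when parents are chosen uniformly at random (uniform descendancy diagrams), and let $Y_i$ be the number of active nodes at level $i$ when, instead, parents are chosen according to the distribution $(p_1,\dots,p_S)$, the same on each level; $X_1= Y_1= S$. Then for every $i\ge 2$ and every $a\in\{1,\dots,S\}$, $$\mathbb{E}[Y_i\mid Y_{i-1}=a]\;\le\;\mathbb{E}[X_i\mid X_{i-1}=a].$$
   Context: A descendancy diagram has levels labeled $1,2,\dots$ from bottom to top, each consisting of $S$ nodes labeled $1,\dots,S$. Each node at a given level chooses, independently of all other nodes, one parent among the $S$ nodes at the next level up. In the uniform model each parent is chosen with probability $1/S$; in the non-uniform model, node $j$ of the next level is chosen as parent with probability $p_j$. A node is active if it has a descendant at level $1$, with all $S$ nodes of level $1$ counted as active; equivalently, a node at level $i$ with $i\ge2$ is active if and only if it is the chosen parent of at least one active node at level $i-1$. The conditional expectation given that level $i-1$ has $a$ active nodes is the expected number of distinct parents chosen by those $a$ nodes under the respective independent parent-selection rule. *)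

(* Defs.v *)
From mathcomp Require Import all_boot all_order all_algebra.
From mathcomp Require Import all_classical all_reals all_analysis.

Set Implicit Arguments.
Unset Strict Implicit.
Unset Printing Implicit Defensive.

Import Order.TTheory GRing.Theory Num.Theory.

Local Open Scope ring_scope.

(* Levels are natural numbers labeled from 1 (level 0 is never used), and the
   [S] nodes of a level are the elements of ['I_S].  A diagram is a function
   [par], where [par i j] is the node of level [i.+1] chosen as parent by
   node [j] of level [i]. *)
Section Diagram.
Variables (S : nat) (par : nat -> 'I_S -> 'I_S).

(* The ancestor at level [i] of node [u] of level 1, so that
   [ancestor 1 u = u] and [ancestor i.+1 u = par i (ancestor i u)]
   for [1 <= i]. *)
Fixpoint ancestor (i : nat) (u : 'I_S) : 'I_S :=
  match i with
  | 0 | 1 => u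
  | i'.+1 => par i' (ancestor i' u)
  end.

Definition active (i : nat) : {set 'I_S} :=
  [set v : 'I_S | [exists u : 'I_S, ancestor i u == v]]%SET.

Definition parents (i : nat) (A : {set 'I_S}) : {set 'I_S} :=
  [set par i j | j in A]%SET.

Lemma active1 : active 1 = [set: 'I_S]%SET.
Proof. by apply/setP => v; rewrite !inE; apply/existsP; exists v. Qed.

Lemma activeS (i : nat) : (1 <= i)%N -> active i.+1 = parents i (active i).
Proof.
case: i => // i _; apply/setP => v; rewrite inE; apply/existsP/imsetP.
  move=> [u /eqP <-]; exists (ancestor i.+1 u) => //.
  by rewrite inE; apply/existsP; exists u.
by move=> [w]; rewrite inE => /existsP[u /eqP <-] ->; exists u.
Qed.

End Diagram.

Section RandomDiagram.
Local Open Scope classical_set_scope.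
Context (R : realType) (S : nat) (d : measure_display) (T : measurableType d).
Variables (P : probability T R) (par : nat -> 'I_S -> T -> 'I_S).

(* [(i, j)] stands for node [j] of level [i]; ['I_S] carries the discrete
   sigma-algebra, and independence is the product rule over all finite
   subfamilies of nodes. *)
Record random_diagram (p : 'I_S -> R) : Prop := RandomDiagram {
  parent_measurable : forall (i : nat) (j : 'I_S) (B : set 'I_S),
    (1 <= i)%N -> measurable [set w | B (par i j w)] ;
  parent_law : forall (i : nat) (j v : 'I_S),
    (1 <= i)%N -> P [set w | par i j w = v] = (p v)%:E ;
  parent_independent : forall (s : seq (nat * 'I_S)%type)
      (B : nat * 'I_S -> set 'I_S),
    uniq s -> (forall x, x \in s -> (1 <= x.1)%N) ->
    P [set w | forall x, x \in s -> B x (par x.1 x.2 w)] =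
    (\prod_(x <- s) P [set w | B x (par x.1 x.2 w)])%E
}.

Definition diagram (w : T) : nat -> 'I_S -> 'I_S := fun i j => par i j w.

Definition num_active (i : nat) (w : T) : nat := #|active (diagram w) i|.

Definition num_parents (i : nat) (A : {set 'I_S}) (w : T) : nat :=
  #|parents (diagram w) i A|.

(* The conditional expectation of the number of active nodes at level [i],
   given that level [i.-1] has [a] active nodes, for [2 <= i].
   When the conditioning event has probability zero (e.g., [i = 2] and
   [a < S]), the value is the expected number of distinct parents chosen by
   [a] nodes of level [i.-1].  We take the first [a] nodes; under
   [random_diagram] the choice is immaterial since parents are i.i.d. *)
Definition cond_num_active (i a : nat) : R :=
  let E := [set w | num_active i.-1 w = a] in
  if P E == 0%E then
    fine 'E_P[fun w => (num_parents i.-1 [set j : 'I_S | (j < a)%N]%SET w)%:R]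
  else
    fine (\int[P]_(w in E) ((num_active i w)%:R)%:E) / fine (P E).

End RandomDiagram.

(* Main.v *)
(** The choices made at level [m] are independent of those made below it, which
    determine the active nodes of level [m].  Hence, given [a] active nodes
    there, node [v] of level [m.+1] is missed with probability [(1 - p v) ^+ a],
    and the conditional expectation is [\sum_v (1 - (1 - p v) ^+ a)].  The
    claim is then Jensen's inequality for [x ^+ a], whose mean point
    [1 - S^-1] does not depend on [p]. *)

Require Import Defs.
From mathcomp Require Import all_boot all_order all_algebra.
From mathcomp Require Import all_classical all_reals all_analysis.
From mathcomp Require Import measurable_realfun ring.

Import Order.TTheory GRing.Theory Num.Theory.

Set Implicit Arguments.
Unset Strict Implicit.
Unset Printing Implicit Defensive.

Local Open Scope ring_scope.

(** * Jensen's inequality for powers *)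

(** A convex function lies above its tangents. In the induction, multiplying the hypothesis by [x]
    leaves a gap of exactly [n.+1%:R * c ^+ n * (x - c) ^+ 2]. *)
Lemma exprn_tangent_le (R : realDomainType) (n : nat) (c x : R) :
  0 <= c -> 0 <= x -> c ^+ n + n%:R * c ^+ n.-1 * (x - c) <= x ^+ n.
Proof.
move=> c0 x0; case: n => [|n] /=; first by rewrite !expr0 !mul0r addr0.
elim: n => [|n IHn]; first by rewrite !expr1 expr0 !mul1r addrC subrK.
rewrite exprS [x ^+ n.+2]exprS; apply: le_trans (ler_wpM2l x0 IHn).
rewrite -subr_ge0 [X in 0 <= X](_ : _ = n.+1%:R * c ^+ n * (x - c) ^+ 2).
  by rewrite mulr_ge0 ?sqr_ge0 // mulr_ge0 ?exprn_ge0.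
by rewrite -[n.+2%:R]natr1 [c ^+ n.+1]exprS; ring.
Qed.

(** Sum the tangent inequalities at the common point [c]: since [c] is the mean of the [x i], the
    linear terms cancel. *)
Lemma sum_exprn_ge_mean (R : realFieldType) (I : finType) (x : I -> R) (c : R)
    (n : nat) :
  0 <= c -> (forall i, 0 <= x i) -> \sum_i x i = \sum_(i : I) c ->
  \sum_(i : I) c ^+ n <= \sum_i x i ^+ n.
Proof.
move=> c0 x0 xc.
have -> : \sum_(i : I) c ^+ n =
    \sum_i (c ^+ n + n%:R * c ^+ n.-1 * (x i - c)).
  by rewrite big_split /= -mulr_sumr sumrB xc subrr mulr0 addr0.
by apply: ler_sum => i _; exact: exprn_tangent_le.
Qed.

(** * Dependence of the active nodes on the levels below *)

Lemma eq_ancestor (S : nat) (par par' : nat -> 'I_S -> 'I_S) (i : nat) :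
  (forall k, (1 <= k < i)%N -> par k =1 par' k) ->
  ancestor par i =1 ancestor par' i.
Proof.
elim: i => [|[|i] IHi] // eq_par u.
rewrite /= -/(ancestor par i.+1 u) -/(ancestor par' i.+1 u).
rewrite IHi; first by apply: eq_par; rewrite /= ltnSn.
by move=> k /andP[k1 ki]; apply: eq_par; rewrite k1 ltnW.
Qed.

Lemma eq_active (S : nat) (par par' : nat -> 'I_S -> 'I_S) (i : nat) :
  (forall k, (1 <= k < i)%N -> par k =1 par' k) ->
  active par i = active par' i.
Proof.
move=> eq_par; apply/setP => v; rewrite !inE.
by apply: eq_existsb => u; rewrite (eq_ancestor eq_par).
Qed.

(** * Independence of a level's choices from the past *)

Section History.
Local Open Scope classical_set_scope.
Context (R : realType) (S : nat) (d : measure_display) (T : measurableType d).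
Variables (P : probability T R) (par : nat -> 'I_S -> T -> 'I_S).
Variables (p : 'I_S -> R) (diag : random_diagram P par p).

Local Notation hist M := {ffun 'I_M * 'I_S -> 'I_S}.

(** Index [k] of ['I_M] stands for level [k.+1]. The type of values is finite, so every event about
    the past is a finite disjoint union of fibres of [history M]. *)
Definition history (M : nat) (w : T) : hist M :=
  [ffun x : 'I_M * 'I_S => par x.1.+1 x.2 w].

(* Outside the levels [1..M], the parent [j] is a junk value (and level 0 reads
   level 1). *)
Definition diagram_of_history (M : nat) (g : hist M) (k : nat) (j : 'I_S) :
    'I_S :=
  if insub k.-1 is Some k' then g (k', j) else j.

Definition missed (v : 'I_S) (i : nat) (A : {set 'I_S}) : set T :=
  [set w | v \notin parents (diagram par w) i A].

(** Level [M.+1] reads only the choices of levels 1 to [M], so the junk values do no harm. Events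
    about the active nodes there thus become events about the history. *)
Lemma active_history (M : nat) (w : T) :
  active (diagram_of_history (history M w)) M.+1 = active (diagram par w) M.+1.
Proof.
apply: eq_active => -[//|k] /= kM j; rewrite /diagram_of_history /=.
by rewrite (insubT (fun k => k < M)%N kM) ffunE.
Qed.

Lemma measurable_all_par (s : seq (nat * 'I_S)) (B : nat * 'I_S -> set 'I_S) :
  (forall x, x \in s -> (1 <= x.1)%N) ->
  measurable [set w | forall x, x \in s -> B x (par x.1 x.2 w)].
Proof.
move=> s1; rewrite [X in measurable X](_ : _ =
  \bigcap_(x in [set` s]) [set w | B x (par x.1 x.2 w)]) //.
by apply: fin_bigcap_measurable => // x /s1; exact: (parent_measurable diag).
Qed.

Lemma missedE (v : 'I_S) (i : nat) (A : {set 'I_S}) :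
  missed v i A = [set w | forall j, j \in A -> par i j w <> v].
Proof.
apply/seteqP; split=> w /=.
  by move=> + j jA ev; apply/negP/negPn; apply/imsetP; exists j.
by move=> missw; apply/imsetP => -[j jA ev]; exact: (missw j jA).
Qed.

Lemma history_preimage1E (M : nat) (g : hist M) :
  history M @^-1` [set g] = [set w | forall x : 'I_M * 'I_S, par x.1.+1 x.2 w = g x].
Proof.
apply/seteqP; split=> w /=; first by move=> <- x; rewrite ffunE.
by move=> gw; apply/ffunP => x; rewrite ffunE.
Qed.

Lemma prob_missed (v : 'I_S) (i : nat) (j : 'I_S) : (1 <= i)%N ->
  P [set w | par i j w <> v] = (1 - p v)%:E.
Proof.
move=> i1; rewrite [X in P X](_ : _ = ~` [set w | par i j w = v]) //.
rewrite probability_setC ?(parent_law diag) //.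
exact: (parent_measurable diag _ [set v]).
Qed.

(** Fixing the history and missing [v] both constrain single nodes, at levels up to [M] and at level
    [M.+1] respectively. The product rule applies to the two disjoint lists of nodes together. *)
Lemma prob_history_missed (M : nat) (g : hist M) (v : 'I_S) (A : {set 'I_S}) :
  P (history M @^-1` [set g] `&` missed v M.+1 A) =
  (P (history M @^-1` [set g]) * ((1 - p v) ^+ #|A|)%:E)%E.
Proof.
pose past : seq (nat * 'I_S) :=
  [seq ((nat_of_ord x.1).+1, x.2) | x : 'I_M * 'I_S].
pose now := [seq (M.+1, j) | j in A].
(* One family of constraints serves both lists: [insub] succeeds on the nodes of [past] and fails on
   those of [now], where [x.1.-1] is [M]. *)
pose B (x : nat * 'I_S) : set 'I_S :=
  if insub x.1.-1 is Some k then [set (g (k, x.2) : 'I_S)]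
  else [set u | u <> v].
have Bpast (x : 'I_M * 'I_S) : B ((nat_of_ord x.1).+1, x.2) = [set g x].
  by rewrite /B /= (valK x.1) -surjective_pairing.
have Bnow j : B (M.+1, j) = [set u | u <> v].
  by rewrite /B /= insubN // -leqNgt.
have past_ge1 x : x \in past -> (1 <= x.1)%N by move=> /mapP[y _ ->].
have now_ge1 x : x \in now -> (1 <= x.1)%N by move=> /mapP[y _ ->].
have past_uniq : uniq past.
  rewrite map_inj_uniq ?enum_uniq // => -[k j] [k' j'] /= [kk' ->].
  by congr (_, _); exact: val_inj.
have now_uniq : uniq now by rewrite map_inj_uniq ?enum_uniq // => j j' [].
have disj : uniq (past ++ now).
  rewrite cat_uniq past_uniq now_uniq andbT /=; apply/hasPn => x.
  move=> /mapP[j _ ->]; apply/negP => /mapP[[k j'] _ [kM _]].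
  by have := ltn_ord k; rewrite -kM ltnn.
have pastE : history M @^-1` [set g] =
    [set w | forall x, x \in past -> B x (par x.1 x.2 w)].
  rewrite history_preimage1E; apply/seteqP; split=> w /= gw.
    by move=> _ /mapP[x _ ->]; rewrite Bpast; exact: gw.
  move=> x; have := gw (x.1.+1, x.2); rewrite Bpast; apply.
  by apply/mapP; exists x; rewrite ?mem_enum.
have bothE : history M @^-1` [set g] `&` missed v M.+1 A =
    [set w | forall x, x \in past ++ now -> B x (par x.1 x.2 w)].
  rewrite pastE missedE; apply/seteqP; split=> w /=.
    move=> [pw nw] x; rewrite mem_cat => /orP[/pw //|/mapP[j jA ->]].
    by rewrite Bnow; apply: nw; rewrite mem_enum in jA.
  move=> bw; split=> [x xp|j jA]; first by apply: bw; rewrite mem_cat xp.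
  have := bw (M.+1, j); rewrite Bnow; apply.
  by rewrite mem_cat; apply/orP; right; apply/mapP; exists j; rewrite ?mem_enum.
rewrite bothE (parent_independent diag) //; last first.
  by move=> x; rewrite mem_cat => /orP[/past_ge1|/now_ge1].
(* The product rule for [past] alone turns its factors back into the probability of the history. *)
rewrite big_cat /= pastE (parent_independent diag) //; congr (_ * _)%E.
rewrite big_image /=.
under eq_bigr => j _ do rewrite Bnow /= prob_missed //.
by rewrite prodEFin prodr_const.
Qed.

Lemma measurable_history (M : nat) (Q : set (hist M)) :
  measurable (history M @^-1` Q).
Proof.
rewrite (_ : _ @^-1` _ = \bigcup_(g in Q) history M @^-1` [set g]); last first.
  by rewrite -preimage_bigcup bigcup_imset1 image_id.
apply: fin_bigcup_measurable => [|g _]; first exact: finite_finset.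
rewrite history_preimage1E.
rewrite [X in measurable X](_ : _ =
  \bigcap_(x in [set: 'I_M * 'I_S]) [set w | par x.1.+1 x.2 w = g x]); last first.
  by apply/seteqP; split=> w /= gw x; [move=> _; exact: gw|exact: gw].
apply: fin_bigcap_measurable => [|x _]; first exact: finite_finset.
exact: (parent_measurable diag _ [set g x]).
Qed.

Lemma measurable_missed (v : 'I_S) (M : nat) (A : {set 'I_S}) :
  measurable (missed v M.+1 A).
Proof.
rewrite missedE [X in measurable X](_ : _ =
  \bigcap_(j in [set` A]) [set w | par M.+1 j w <> v]) //.
apply: fin_bigcap_measurable => [|j _]; first exact: finite_finset.
exact: (parent_measurable diag _ [set u | u <> v]).
Qed.

(** * Conditioning on a past event *)

Section Conditioning.
Variables (M a : nat) (Q : set (hist M)) (A : hist M -> {set 'I_S}).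

(** Here the set of nodes choosing parents is itself random, but determined by the past. *)
Definition missed_history (v : 'I_S) : set T :=
  [set w | missed v M.+1 (A (history M w)) w].

Lemma missed_historyE (v : 'I_S) (Q' : set (hist M)) :
  history M @^-1` Q' `&` missed_history v =
  \bigcup_(g in Q') (history M @^-1` [set g] `&` missed v M.+1 (A g)).
Proof.
apply/seteqP; split=> w /= [].
  by move=> Qw missw; exists (history M w).
by move=> g Qg [gw]; rewrite -gw in Qg *.
Qed.

Lemma measurable_missed_history (v : 'I_S) : measurable (missed_history v).
Proof.
rewrite -[missed_history v]setTI -(preimage_setT (history M)) missed_historyE.
apply: fin_bigcup_measurable => [|g _]; first exact: finite_finset.
by apply: measurableI; [exact: measurable_history|exact: measurable_missed].
Qed.

Hypothesis cardA : forall g, Q g -> #|A g| = a.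

(** On each fibre in [Q] the random set is a fixed set of [a] nodes, so the same factor
    [(1 - p v) ^+ a] comes out of every term of the sum over fibres. *)
Lemma prob_missed_history (v : 'I_S) :
  P (history M @^-1` Q `&` missed_history v) =
  (P (history M @^-1` Q) * ((1 - p v) ^+ a)%:E)%E.
Proof.
have QE : history M @^-1` Q = \bigcup_(g in Q) history M @^-1` [set g].
  by rewrite -preimage_bigcup bigcup_imset1 image_id.
rewrite missed_historyE [in RHS]QE !measure_fin_bigcup //.
- rewrite ge0_mule_fsuml //; apply: eq_fsbigr => g; rewrite inE => Qg.
  by rewrite -(cardA Qg); exact: prob_history_missed.
- exact: finite_finset.
- exact: trivIset_preimage1.
- by move=> g _; exact: measurable_history.
- exact: finite_finset.
- by apply: trivIset_setIr; exact: trivIset_preimage1.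
- move=> g _.
  by apply: measurableI; [exact: measurable_history|exact: measurable_missed].
Qed.

(** The number of parents is the sum over [v] of the indicators that [v] is not missed, so linearity
    suffices. Without division by the probability of the event, the identity also covers null
    events. *)
Lemma integral_num_parents :
  (\int[P]_(w in history M @^-1` Q)
     (num_parents par M.+1 (A (history M w)) w)%:R%:E)%E =
  (P (history M @^-1` Q) * (\sum_v (1 - (1 - p v) ^+ a))%:E)%E.
Proof.
have mH := measurable_history Q.
have Pfin : P (history M @^-1` Q) \is a fin_num by exact: fin_num_measure.
under eq_integral => w _.
  rewrite (_ : _%:E = (\sum_v (\1_(~` missed_history v) w)%:E)%E); last first.
    rewrite sumEFin /num_parents -sum1_card natr_sum big_mkcond /=.
    congr (_%:E); apply: eq_bigr => v _.
    rewrite indicE in_setC /missed_history; case: ifPn => vA.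
      by rewrite memNset //= => /negP.
    by rewrite mem_set.
  over.
have mN v := measurableC (measurable_missed_history v).
have mI v : measurable_fun (history M @^-1` Q)
    (EFin \o (\1_(~` missed_history v) : T -> R)).
  by apply/measurable_EFinP; exact: measurable_indic.
rewrite ge0_integral_sum //.
rewrite -(fineK Pfin) -EFinM mulr_sumr -sumEFin; apply: eq_bigr => v _.
rewrite integral_indic // setIC -setDE.
have : P (history M @^-1` Q) =
    (P (history M @^-1` Q `\` missed_history v) +
     P (history M @^-1` Q `&` missed_history v))%E.
  exact: measureDI mH (measurable_missed_history v).
rewrite prob_missed_history -(fineK Pfin) -EFinM.
(* Solve for the probability that [v] is not missed; the subtracted term is finite. *)
move=> /(congr1 (fun x => x - (fine (P (history M @^-1` Q)) *
  (1 - p v) ^+ a)%:E)%E).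
rewrite addeK // => PD; apply: etrans (esym PD) _.
by rewrite -EFinB mulrBr mulr1.
Qed.
End Conditioning.

(** Both branches of the definition are instances of [integral_num_parents], so null conditioning
    events give the same value. *)
Lemma cond_num_activeE (i a : nat) : (2 <= i)%N -> (a <= S)%N ->
  cond_num_active P par i a = \sum_v (1 - (1 - p v) ^+ a).
Proof.
case: i => [|[|M]] // _ aS; rewrite /cond_num_active /=.
case: ifPn => [_|PE].
  (* In the null branch the set of nodes is constant and [Q] is the full set; the bound [a <= S]
     ensures that there are [a] first nodes. *)
  have cardA : #|[set j : 'I_S | (j < a)%N]%SET| = a.
    by rewrite -sum1dep_card (big_ord_narrow aS) sum1_card card_ord.
  rewrite expectation.unlock -(preimage_setT (history M)).
  rewrite (@integral_num_parents M a setT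
    (fun=> [set j : 'I_S | (j < a)%N]%SET)) //.
  by rewrite preimage_setT probability_setT mul1e.
pose act (g : hist M) := active (diagram_of_history g) M.+1.
pose Q : set (hist M) := [set g | #|act g| = a].
(* The conditioning event concerns the past only, and on it the active set has [a] elements by
   definition. *)
have EE : [set w | num_active par M.+1 w = a] = history M @^-1` Q.
  apply/seteqP; split=> w; rewrite /Q /act /= /num_active;
    by rewrite active_history.
have PEfin : P (history M @^-1` Q) \is a fin_num.
  exact: fin_num_measure (measurable_history Q).
rewrite EE in PE *.
under eq_integral => w _.
  rewrite (_ : num_active par M.+2 w =
    num_parents par M.+1 (act (history M w)) w).
    over.
  by rewrite /num_active activeS // /act active_history.
rewrite (@integral_num_parents M a) // fineM // mulrAC divff ?mul1r //.
by rewrite fine_eq0.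
Qed.

End History.

Theorem lemma2p6 (R : realType) (S : nat) (S_gt0 : (0 < S)%N)
    (p : 'I_S -> R) (p_ge0 : forall j, 0 <= p j) (p_sum1 : \sum_j p j = 1)
    (p_nonuniform : exists j, p j != S%:R^-1)
    (dX : measure_display) (TX : measurableType dX) (PX : probability TX R)
    (parX : nat -> 'I_S -> TX -> 'I_S)
    (hX : random_diagram PX parX (fun=> S%:R^-1))
    (dY : measure_display) (TY : measurableType dY) (PY : probability TY R)
    (parY : nat -> 'I_S -> TY -> 'I_S)
    (hY : random_diagram PY parY p)
    (i : nat) (i_ge2 : (2 <= i)%N) (a : nat) (a_range : (1 <= a <= S)%N) :
  cond_num_active PY parY i a <= cond_num_active PX parX i a.
Proof.
have [_ aS] := andP a_range.
rewrite (cond_num_activeE hX) // (cond_num_activeE hY) //.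
rewrite !sumrB lerD2l lerN2.
have S0 : S%:R != 0 :> R by rewrite pnatr_eq0 -lt0n.
(* What remains compares the powers of [1 - p v] with those of [1 - S%:R^-1], their mean because
   both distributions have total mass 1. *)
apply: sum_exprn_ge_mean.
- by rewrite subr_ge0 invf_le1 ?ler1n ?ltr0n.
- move=> j; rewrite subr_ge0 -p_sum1 (bigD1 j) //= lerDl.
  by apply: sumr_ge0 => k _; exact: p_ge0.
- have sum_unif : \sum_(j < S) S%:R^-1 = 1 :> R.
    by rewrite sumr_const card_ord -[LHS]mulr_natr mulVf.
  by rewrite !sumrB p_sum1 sum_unif.
Qed.
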